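(* Let $n>40$ be an integer and let $\mathcal H$ be a (not necessarily uniform) hypergraph on $n$ vertices, and let $d_1\leq d_2\leq \dots\leq d_n$ be the degrees of its vertices listed in nondecreasing order. Suppose that (1) $d_i>2^i$ for all $1\leq i\leq \lfloor\frac{n-1}{2}\rfloor$; (2) if $n$ is even, then $d_{\frac{n-2}{2}}>2^{\frac{n-2}{2}}+1$. Then $\mathcal H$ contains a Hamiltonian Berge cycle.
   Context: A hypergraph $\mathcal H$ consists of a finite vertex set $V(\mathcal H)$ and a set $E(\mathcal H)$ of distinct subsets of $V(\mathcal H)$ (of arbitrary sizes) called hyperedges; no hyperedge appears more than once. The degree $d(v)$ of a vertex $v$ is the number of hyperedges containing $v$. A Berge cycle of length $t$ is a sequence $v_1,e_1,v_2,e_2,\dots,v_t,e_t$ of $t$ distinct vertices and $t$ distinct hyperedges such that $\{v_i,v_{i+1}\}\subseteq e_i$ for all $i\in[t]$, indices modulo $t$. A Berge cycle is Hamiltonian if its vertices $v_1,\dots,v_t$ are all the vertices of $\mathcal H$ (i.e. $t=n$). *)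

(* Defs.v *)
From mathcomp Require Import all_boot.
Set Implicit Arguments. Unset Strict Implicit. Unset Printing Implicit Defensive.

Definition hypergraph (T : finType) := {set {set T}}.

Definition hdeg (T : finType) (E : hypergraph T) (v : T) : nat :=
  #|[set e in E | v \in e]|.

Definition sorted_degrees (T : finType) (E : hypergraph T) : seq nat :=
  sort leq [seq hdeg E v | v <- enum T].

(* d_i with the paper's 1-based indexing: d_i = nth 0 (sorted degrees) (i-1) *)
Definition sdeg (T : finType) (E : hypergraph T) (i : nat) : nat :=
  nth 0 (sorted_degrees E) i.-1.

(* A Berge cycle of length t: v_1,e_1,...,v_t,e_t with distinct vertices
   (f injective), distinct hyperedges of E (g injective), and
   {v_i, v_(i+1)} ⊆ e_i, indices mod t (ordS i = i+1 mod t). *)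
Definition berge_cycle (T : finType) (E : hypergraph T) (t : nat)
    (f : 'I_t -> T) (g : 'I_t -> {set T}) : Prop :=
  [/\ injective f, injective g,
      forall i, g i \in E,
      forall i, f i \in g i &
      forall i, f (ordS i) \in g i].

Definition has_hamiltonian_berge_cycle (T : finType) (E : hypergraph T) : Prop :=
  exists t (f : 'I_t -> T) (g : 'I_t -> {set T}),
    berge_cycle E f g /\ t = #|T| /\ (forall v : T, exists i, f i = v).

(* Main.v *)
(* Fix a vertex y and let W be the set of the vertices x joined to y by a Hamiltonian Berge path.
   Pósa rotations show that every u in W has degree at most 2^|W|: on a Hamiltonian path from u to y
   the successors of W form a set K of size |W|, each unused edge at u lies in K + u, and if
   d(u) > 2^|W| then almost all subsets of K + u are unused edges; this makes it possible to reroute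
   the path and to free each used edge at u in turn, so that it lies in K + u as well.

   Let H be a counterexample.  After adding edges, H has a Hamiltonian path; choose its ends u, y
   with d(u) + d(y) maximal and d(u) <= d(y).  Then all of W has degree at most d(u), so (1) gives
   |W| > m := (n-1)/2 (rounded down) and d(u) > 2^m.  As y has at least m neighbours of large codegree,
   none of them in W, n is even and, writing C, D for u and y with their large-codegree neighbours,
   |C| = |D| = m + 1, W is the complement of D, and symmetrically for u.  By (2), u has two edges not
   inside C, and they are used in every Hamiltonian path from u to y.  Such a path has exactly one
   step from outside D to outside C.  Rerouting along an edge at u that leaves C shows that this step
   starts in C \ D and ends outside C and D; the reversed path gives a contradiction. *)
Require Import Defs.
From mathcomp Require Import all_boot boolp zify.
Set Implicit Arguments. Unset Strict Implicit. Unset Printing Implicit Defensive.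

(** * Berge paths *)

(* Only v_0, ..., v_L and e_0, ..., e_(L-1) matter; when #|T| = L.+1 the path is Hamiltonian. *)
Definition hpath (T : finType) (E : hypergraph T) (L : nat)
    (v : nat -> T) (e : nat -> {set T}) : Prop :=
  [/\ forall i j, i <= L -> j <= L -> v i = v j -> i = j,
      forall i j, i < L -> j < L -> e i = e j -> i = j &
      forall i, i < L -> [/\ e i \in E, v i \in e i & v i.+1 \in e i]].

(** The cycle is cut open into a path and a closing edge [f], so that no index has to be taken
    modulo [L.+1]. *)
Definition hcycle (T : finType) (E : hypergraph T) (L : nat) : Prop :=
  exists v e, hpath E L v e /\ exists f, [/\ f \in E,
    forall i, i < L -> e i <> f, v L \in f & v 0 \in f].

Definition upd (A : Type) (e : nat -> A) (i : nat) (x : A) : nat -> A :=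
  fun k => if k == i then x else e k.

(** With [#|T| = L.+1] this is the set W of the introduction. *)
Definition ends (T : finType) (E : hypergraph T) (L : nat) (y : T) : {set T} :=
  [set x | `[< exists v e, [/\ hpath E L v e, v 0 = x & v L = y] >]].

Section Paths.
Variables (T : finType) (E : hypergraph T) (L : nat).
Implicit Types (v : nat -> T) (e : nat -> {set T}).

Lemma upd_inj e i f :
  (forall a b, a < L -> b < L -> e a = e b -> a = b) ->
  (forall k, k < L -> k <> i -> e k <> f) ->
  forall a b, a < L -> b < L -> upd e i f a = upd e i f b -> a = b.
Proof.
move=> ie hf a b aL bL; rewrite /upd.
case: eqP => [->|na]; case: eqP => [->|nb] // h; last exact: ie.
- by case: (hf b bL nb).
- by case: (hf a aL na).
Qed.

Lemma hpath_upd v e i f : hpath E L v e -> f \in E ->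
  (forall k, k < L -> k <> i -> e k <> f) ->
  v i \in f -> v i.+1 \in f -> hpath E L v (upd e i f).
Proof.
move=> [iv ie he] fE hf vi vi1; split=> //; first exact: upd_inj.
by move=> k kL; rewrite /upd; case: eqP => [->//|_]; exact: he.
Qed.

(** Every rerouting permutes vertex positions by [s] and edge positions by [t], after possibly
    replacing some edges; only the incidences then depend on the rerouting. *)
Lemma hpath_reindex v e e' (s t : nat -> nat) :
  hpath E L v e ->
  (forall a b, a < L -> b < L -> e' a = e' b -> a = b) ->
  (forall k, k <= L -> s k <= L) ->
  (forall a b, a <= L -> b <= L -> s a = s b -> a = b) ->
  (forall k, k < L -> t k < L) ->
  (forall a b, a < L -> b < L -> t a = t b -> a = b) ->
  (forall k, k < L -> [/\ e' (t k) \in E, v (s k) \in e' (t k)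
     & v (s k.+1) \in e' (t k)]) ->
  hpath E L (v \o s) (e' \o t).
Proof.
move=> [iv _ _] ie' sL si tL ti h; split=> //=.
- by move=> a b aL bL /iv h'; apply: si => //; apply: h'; exact: sL.
- by move=> a b aL bL /ie' h'; apply: ti => //; apply: h'; exact: tL.
Qed.

Lemma hpath_rev v e : hpath E L v e ->
  hpath E L (fun k => v (L - k)) (fun k => e (L.-1 - k)).
Proof.
move=> hp; case: (hp) => _ ie he.
apply: (@hpath_reindex v e e (fun k => L - k) (fun k => L.-1 - k)) => //; try lia.
move=> k kL; have := he (L.-1 - k).
have -> : (L.-1 - k).+1 = L - k by lia.
have -> : L.-1 - k = L - k.+1 by lia.
by move=> h; case: h => //; lia.
Qed.

(* v_j ... v_0 -f- v_(j+1) ... v_L *)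
Lemma hpath_rot v e j f : hpath E L v e -> j < L -> f \in E ->
  (forall k, k < L -> k <> j -> e k <> f) -> v 0 \in f -> v j.+1 \in f ->
  hpath E L (v \o (fun k => if k <= j then j - k else k))
            (upd e j f \o (fun k => if k < j then j.-1 - k else k)).
Proof.
move=> hp jL fE hf v0 vj; case: (hp) => _ ie he.
apply: (hpath_reindex hp) => //; first exact: upd_inj.
- by move=> k; case: ifP; lia.
- by move=> a b aL bL; case: ifP => ?; case: ifP => ?; lia.
- by move=> k; case: ifP; lia.
- by move=> a b aL bL; case: ifP => ?; case: ifP => ?; lia.
move=> k kL; rewrite /upd; have [kj|kj|->] := ltngtP k j.
- rewrite ifN; last by apply/eqP; lia.
  have := he (j.-1 - k).
  have -> : (j.-1 - k).+1 = j - k by lia.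
  have -> : j.-1 - k = j - k.+1 by lia.
  by move=> h; case: h => //; lia.
- rewrite ifN; last by apply/eqP; lia.
  exact: he.
- by rewrite eqxx subnn.
Qed.

(* v_0 -f- v_i ... v_1 -h- v_(i+1) ... v_L *)
Lemma hpath_inner v e i f h : hpath E L v e -> 0 < i < L -> f \in E -> h \in E ->
  f <> h ->
  (forall k, k < L -> k <> 0 -> k <> i -> e k <> f) ->
  (forall k, k < L -> k <> 0 -> k <> i -> e k <> h) ->
  v 0 \in f -> v i \in f -> v 1 \in h -> v i.+1 \in h ->
  hpath E L (v \o (fun k => if 0 < k <= i then i.+1 - k else k))
            (upd (upd e 0 f) i h \o (fun k => if 0 < k < i then i - k else k)).
Proof.
move=> hp iL fE hE fh hf hh f0 fi h1 hi; case: (hp) => _ ie he.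
have i0 : (i == 0) = false by lia.
apply: (hpath_reindex hp) => //.
- move=> a b aL bL; rewrite /upd.
  have [|ai] := eqVneq a i; have [|bi] := eqVneq b i; rewrite //.
  + by move=> -> -> .
  + move=> -> ; case: eqVneq => [_ /esym //|b0 hE']; case: (hh b bL _ _ (esym hE')); exact/eqP.
  + move=> ->; case: eqVneq => [//|a0 hE']; case: (hh a aL _ _ hE'); exact/eqP.
  have [->|a0] := eqVneq a 0; have [->|b0] := eqVneq b 0; rewrite //.
  + by move/esym/hf => H; case: H => //; exact/eqP.
  + by move/hf => H; case: H => //; exact/eqP.
  exact: ie.
- by move=> k; case: ifP; lia.
- by move=> a b aL bL; case: ifP => ?; case: ifP => ?; lia.
- by move=> k; case: ifP; lia.
- by move=> a b aL bL; case: ifP => ?; case: ifP => ?; lia.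
move=> k kL; rewrite /upd; have [->|[ki|[ki|->]]] : k = 0 \/ 0 < k < i \/ i < k \/ k = i by lia.
- rewrite /= [0 == i]eq_sym i0 /=; split=> //.
  by rewrite subn1 ifT //; lia.
- have -> : 0 < k <= i by lia.
  have -> : 0 < k.+1 <= i by lia.
  rewrite ki.
  have -> : (i - k == i) = false by lia.
  have -> : (i - k == 0) = false by lia.
  have := he (i - k).
  have -> : i.+1 - k = (i - k).+1 by lia.
  by rewrite subSS => H; case: H => //; lia.
- have -> : (0 < k < i) = false by lia.
  have -> : (0 < k <= i) = false by lia.
  have -> : (0 < k.+1 <= i) = false by lia.
  have -> : (k == i) = false by lia.
  have -> : (k == 0) = false by lia.
  exact: he.
- have -> : (0 < i < i) = false by lia.
  have -> : 0 < i <= i by lia.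
  have -> : (0 < i.+1 <= i) = false by lia.
  by rewrite eqxx subSnn.
Qed.

(* v_(l+1) ... v_i -(e_i)- v_0 ... v_l -h- v_(i+1) ... v_L *)
Lemma hpath_swap v e l i h : hpath E L v e -> l < i < L -> h \in E ->
  (forall k, k < L -> k <> l -> e k <> h) ->
  v 0 \in e i -> v l \in h -> v i.+1 \in h ->
  hpath E L
    (v \o (fun k => if k < i - l then l.+1 + k else if k <= i then k - (i - l) else k))
    (upd e l h \o (fun k => if k < (i - l).-1 then l.+1 + k
       else if k == (i - l).-1 then i else if k < i then k - (i - l)
       else if k == i then l else k)).
Proof.
move=> hp il hE hh v0 vl vi; case: (hp) => _ ie he.
apply: (hpath_reindex hp) => //; first exact: upd_inj.
- by move=> k kL; repeat case: ifP => ?; lia.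
- by move=> a b aL bL; repeat case: ifP => ?; lia.
- by move=> k kL; repeat case: ifP => ?; lia.
- move=> a b aL bL.
  by repeat case: ifP => ?; lia.
move=> k kL; rewrite /upd.
have [k1|[k1|[k1|[->|k1]]]] :
  k < (i - l).-1 \/ k = (i - l).-1 \/ i - l <= k < i \/ k = i \/ i < k by lia.
- have -> : k < i - l by lia.
  have -> : k.+1 < i - l by lia.
  rewrite k1; have -> : (l.+1 + k == l) = false by lia.
  by rewrite addnS; apply: he; lia.
- have -> : k < i - l by lia.
  have -> : (k.+1 < i - l) = false by lia.
  have -> : k < i by lia.
  rewrite k1 ltnn eqxx (_ : (i == l) = false); last by lia.
  have -> : (i - l).-1.+1 - (i - l) = 0 by lia.
  have -> : l.+1 + (i - l).-1 = i by lia.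
  by case: (he i) => //; lia.
- have -> : (k < i - l) = false by lia.
  have -> : (k.+1 < i - l) = false by lia.
  have -> : k <= i by lia.
  have -> : k < i by lia.
  have -> : (k < (i - l).-1) = false by lia.
  have -> : (k == (i - l).-1) = false by lia.
  have -> : (k - (i - l) == l) = false by lia.
  have -> : k.+1 - (i - l) = (k - (i - l)).+1 by lia.
  by apply: he; lia.
- have -> : (i < i - l) = false by lia.
  have -> : (i.+1 < i - l) = false by lia.
  have -> : (i < (i - l).-1) = false by lia.
  have -> : (i == (i - l).-1) = false by lia.
  rewrite ltnn leqnn !eqxx.
  by have -> : i - (i - l) = l by lia.
have -> : (k < i - l) = false by lia.
have -> : (k.+1 < i - l) = false by lia.
have -> : (k < (i - l).-1) = false by lia.
have -> : (k == (i - l).-1) = false by lia.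
have -> : (k <= i) = false by lia.
have -> : (k < i) = false by lia.
have -> : (k == i) = false by lia.
have -> : (k == l) = false by lia.
exact: he.
Qed.

End Paths.

(** * Counting *)

Section Counting.
Variable T : finType.
Implicit Types (F : {set {set T}}) (B C K : {set T}).

(** Such an [f] is determined by [f :&: C]. *)
Lemma card_sandwich F B C :
  (forall f, f \in F -> B \subset f /\ f \subset B :|: C) -> #|F| <= 2 ^ #|C|.
Proof.
move=> hF; have inj : {in F &, injective (fun f => f :&: C)}.
  move=> f g /hF[Bf fBC] /hF[Bg gBC] /= fg.
  have hB (h : {set T}) : B \subset h -> h \subset B :|: C -> h = B :|: (h :&: C).
    by move=> Bh hBC; rewrite setUIr (setUidPr Bh) setIC; apply/esym/setIidPr.
  by rewrite (hB f) // (hB g) // fg.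
rewrite -(card_in_imset inj) -card_powerset; apply/subset_leq_card/subsetP => g.
by case/imsetP => f _ ->; rewrite inE subsetIr.
Qed.

(** The members of [F] that miss [x] lie between [[set u]] and [u |: (K :\ x)]. *)
Lemma card_star_mem F u K x :
  (forall f, f \in F -> u \in f /\ f \subset u |: K) -> x \in K -> u \notin K ->
  #|F| <= 2 ^ #|K|.-1 + #|[set f in F | x \in f]|.
Proof.
move=> hF xK uK; rewrite -(cardsID [set f : {set T} | x \in f] F) addnC leq_add //.
  have -> : #|K|.-1 = #|K :\ x| by rewrite (cardsD1 x K) xK.
  apply: (@card_sandwich _ [set u]) => f; rewrite !inE => /andP[xf /hF[uf /subsetP fK]].
  rewrite sub1set; split=> //; apply/subsetP => z zf; have := fK z zf; rewrite !inE.
  by case: eqVneq => //= _ ->; rewrite andbT; apply: contraNneq xf => <-.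
by apply/subset_leq_card/subsetP => f; rewrite !inE.
Qed.

Lemma card_star_mem2 F u K x z :
  (forall f, f \in F -> u \in f /\ f \subset u |: K) ->
  x \in K -> z \in K -> x != z -> u \notin K ->
  #|F| <= 2 ^ #|K|.-1 + 2 ^ #|K|.-2 + #|[set f in F | (x \in f) && (z \in f)]|.
Proof.
move=> hF xK zK xz uK; apply: leq_trans (card_star_mem hF xK uK) _.
rewrite -addnA leq_add2l -(cardsID [set f : {set T} | z \in f]) addnC leq_add //.
  have -> : #|K|.-2 = #|K :\ x :\ z|.
    by rewrite (cardsD1 x K) xK (cardsD1 z (K :\ x)) !inE eq_sym xz zK.
  apply: (@card_sandwich _ [set u; x]) => f; rewrite !inE.
  case/and3P => zf /hF[uf /subsetP fK] xf.
  rewrite subUset !sub1set uf; split=> //; apply/subsetP => w wf.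
  have := fK w wf; rewrite !inE; case: eqVneq => //= _ ->.
  by case: eqVneq => //= _; rewrite andbT; apply: contraNneq zf => <-.
by apply/subset_leq_card/subsetP => f; rewrite !inE andbA.
Qed.
End Counting.

(** * Ends of Hamiltonian paths and Pósa rotations *)

Section Ends.
Variables (T : finType) (E : hypergraph T) (L : nat).
Hypothesis cardT : #|T| = L.+1.
Implicit Types (v : nat -> T) (e : nat -> {set T}) (A : {set T}).

Lemma hpath_surj v e x : hpath E L v e -> exists2 j, j <= L & v j = x.
Proof.
case=> iv _ _; have inj : injective (fun i : 'I_L.+1 => v i).
  by move=> i j /iv h; apply/val_inj/h; rewrite -ltnS.
have [|g _ gK] := @inj_card_bij _ _ _ inj; first by rewrite card_ord cardT.
by exists (g x); [rewrite -ltnS | exact: gK].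
Qed.

Lemma mem_ends v e : hpath E L v e -> v 0 \in ends E L (v L).
Proof. by move=> hp; rewrite inE; apply/asboolP; exists v, e. Qed.

Lemma ends_path x y : x \in ends E L y ->
  exists v e, [/\ hpath E L v e, v 0 = x & v L = y].
Proof. by rewrite inE => /asboolP. Qed.

Lemma ends_sym x y : x \in ends E L y -> y \in ends E L x.
Proof.
case/ends_path => v [e [hp <- <-]]; have := mem_ends (hpath_rev hp).
by rewrite subn0 subnn.
Qed.

Lemma ends_irr y : 0 < L -> y \notin ends E L y.
Proof.
move=> L0; apply/negP => /ends_path[v [e [[iv _ _] h1 h2]]].
have := iv 0 L (leq0n _) (leqnn _); rewrite h1 h2 => /(_ erefl) L0'.
by rewrite -L0' in L0.
Qed.

(** Position [j] is exempt because the rotation drops [e j]. So [f] may be [e j] itself, and used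
    edges at [v 0] yield ends too. *)
Lemma rot_ends v e j f : hpath E L v e -> j < L -> f \in E ->
  (forall k, k < L -> k <> j -> e k <> f) -> v 0 \in f -> v j.+1 \in f ->
  v j \in ends E L (v L).
Proof.
move=> hp jL fE hf v0 vj; have := mem_ends (hpath_rot hp jL fE hf v0 vj).
by rewrite /= subn0 leqNgt jL.
Qed.

Lemma card_pred_idx v e A : hpath E L v e ->
  #|[set k : 'I_L | v k \in A]| = #|A :\ v L|.
Proof.
move=> hp; case: (hp) => iv _ _.
rewrite -(@card_in_imset _ _ (fun k : 'I_L => v k)); last first.
  by move=> i j _ _ /iv h; apply/val_inj/h; exact: ltnW.
congr #|pred_of_set _|; apply/setP => x; rewrite !inE.
apply/imsetP/andP => [[k kA ->]|[xL xA]].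
  rewrite inE in kA; split=> //; apply/eqP => /iv h.
  by have := ltn_ord k; rewrite h //; [rewrite ltnn | exact: ltnW].
have [j jL vj] := hpath_surj x hp.
have jL' : j < L by rewrite ltn_neqAle jL andbT; apply: contraNneq xL => <-; rewrite vj.
by exists (Ordinal jL'); rewrite ?inE /= vj.
Qed.

Lemma card_succ_idx v e A : hpath E L v e ->
  #|[set k : 'I_L | v k.+1 \in A]| = #|A :\ v 0|.
Proof.
move=> hp; case: (hp) => iv _ _.
rewrite -(@card_in_imset _ _ (fun k : 'I_L => v k.+1)); last first.
  by move=> i j _ _ /iv h; apply/val_inj; case: (h (ltn_ord i) (ltn_ord j)).
congr #|pred_of_set _|; apply/setP => x; rewrite !inE.
apply/imsetP/andP => [[k kA ->]|[xL xA]].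
  by rewrite inE in kA; split=> //; apply/eqP => /iv h; have := h (ltn_ord k) isT.
have [[|j] jL vj] := hpath_surj x hp; first by rewrite vj eqxx in xL.
by exists (Ordinal jL); rewrite ?inE /= vj.
Qed.

End Ends.

(* [lia] fails to identify cardinals that differ only in their (convertible) finType instances. *)
Ltac clia :=
  repeat match goal with H : context [card.body _] |- _ => revert H end;
  repeat (let x := fresh "x" in set x := #|_|; move: x => x); lia.

(** * The degree bound *)

Section DegreeBound.
Variables (T : finType) (E : hypergraph T) (L : nat).
Hypotheses (cardT : #|T| = L.+1) (L_gt0 : 0 < L).
Implicit Types (v : nat -> T) (e : nat -> {set T}) (A : {set T}).

(** For [A] the set W, this is the set K of the introduction. *)
Definition succs v A : {set T} :=
  [set v (val k).+1 | k in [set k : 'I_L | v (val k) \in A]].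

Lemma mem_succs v A k : k < L -> v k \in A -> v k.+1 \in succs v A.
Proof. by move=> kL kA; apply/imsetP; exists (Ordinal kL); rewrite ?inE. Qed.

Lemma card_succs v e A : hpath E L v e -> v L \notin A -> #|succs v A| = #|A|.
Proof.
move=> hp vA; rewrite card_in_imset ?(card_pred_idx cardT _ hp).
  by rewrite (cardsD1 (v L) A) (negPf vA).
case: hp => iv _ _ i j _ _ /iv h; apply/val_inj.
by case: (h (ltn_ord i) (ltn_ord j)).
Qed.

Lemma head_notin_succs v e A : hpath E L v e -> v 0 \notin succs v A.
Proof.
case=> iv _ _; apply/imsetP => -[k _ /iv h].
by have := h isT (ltn_ord k).
Qed.

(** If [f] contains [v k.+1], rotating along [f] makes [v k] an end. *)
Lemma free_sub_succs v e f : hpath E L v e -> f \in E -> v 0 \in f ->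
  (forall k, k < L -> e k <> f) -> f \subset v 0 |: succs v (ends E L (v L)).
Proof.
move=> hp fE f0 hf; apply/subsetP => x xf.
have [[|k] kL vk] := hpath_surj cardT x hp; first by rewrite -vk !inE eqxx.
rewrite -vk inE mem_succs ?orbT //.
by apply: (rot_ends hp kL fE) => // [j jL _|]; [exact: hf | rewrite vk].
Qed.

(** Assuming the degree of [u] exceeds [2 ^ w], every edge at [u], used or not, is shown to lie in
    [u |: K]; but at most [2 ^ w] edges at [u] do. *)
Lemma hdeg_le_ends v e : hpath E L v e ->
  hdeg E (v 0) <= 2 ^ #|ends E L (v L)|.
Proof.
move=> hp; rewrite leqNgt; apply/negP => deg_gt.
set u := v 0 in deg_gt *; set W := ends E L (v L) in deg_gt *.
pose K := succs v W; have [w cW] : {w | #|W| = w} by exists #|W|.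
rewrite cW in deg_gt.
have [iv ie he] := hp.
have yW : v L \notin W by exact: ends_irr.
have uW : u \in W := mem_ends hp.
have cK : #|K| = w by rewrite -cW; exact: card_succs hp yW.
have uK : u \notin K := head_notin_succs W hp.
have v1K : v 1 \in K by exact: mem_succs.
have w1 : 0 < w by rewrite -cW; apply/card_gt0P; exists u.
have PW k : k < L -> u \in e k -> v k \in W.
  move=> kL uk; have [eE _ ek1] := he k kL.
  by apply: (rot_ends hp kL eE) => // j jL jk /ie h; apply: jk; apply: h.
(* [e 0] stays out of [Q]: it can be replaced by another edge through [u] and [v 1], so it is
   treated as nearly free. *)
pose Q := [set e (val k) | k in [set k : 'I_L | (0 < val k) && (u \in e (val k))]].
pose F := [set f in E | u \in f] :\: Q.
have FP f : f \in F -> [/\ f \in E, u \in f & forall k, k < L -> k <> 0 -> e k <> f].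
  rewrite !inE => /andP[fQ /andP[fE uf]]; split=> // k kL k0 ef.
  case/negP: fQ; apply/imsetP; exists (Ordinal kL); rewrite ?inE //= ef uf andbT; lia.
have cF : 2 ^ w + 2 <= #|F| + w.
  (* Edges of [Q] sit at positions [k] with [v k] in [W]; position 0 is a further such position,
     whence the strict inequality. *)
  have cQ : #|Q| < w.
    apply: leq_ltn_trans (leq_imset_card _ _) _.
    have -> : w = #|[set k : 'I_L | v k \in W]|.
      by rewrite (card_pred_idx cardT W hp) -cW (cardsD1 (v L) W) (negPf yW).
    apply/proper_card/properP; split.
      apply/subsetP => k; rewrite in_set => /andP[_ uk].
      by rewrite in_set PW ?ltn_ord.
    by exists (Ordinal L_gt0); rewrite in_set.
  have := cardsID Q [set f in E | u \in f]; rewrite -/F.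
  have := subset_leq_card (subsetIr [set f in E | u \in f] Q).
  rewrite /hdeg in deg_gt; clia.
have FC f : f \in E -> u \in f -> f \notin F -> exists2 k, 0 < k < L & f = e k.
  move=> fE uf; rewrite in_setD in_set fE uf /= andbT negbK => /imsetP[k].
  by rewrite inE => /andP[k0 _] ->; exists (val k); rewrite // k0 ltn_ord.
clearbody F; clear Q.
have wexp : w <= 2 ^ w.-1 by have := @ltn_expl 2 w.-1 isT; lia.
have wexp1 : 2 ^ w = 2 ^ w.-1 + 2 ^ w.-1 by rewrite -{1}(prednK w1) expnS mul2n addnn.
have e0F : forall f, f \in F -> f != e 0 -> forall k, k < L -> e k <> f.
  move=> f /FP[_ _ hf] f0 [|k] kL; first by move/eqP: f0 => f0 /esym.
  exact: hf.
have Fsub1 f : f \in F -> f != e 0 -> f \subset u |: K.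
  move=> fF f0; have [fE uf _] := FP f fF.
  by apply: (free_sub_succs hp) => //; exact: e0F.
have Fsub f : f \in F -> u \in f /\ f \subset u |: K.
  move=> fF; have [_ uf _] := FP f fF; split=> //.
  (* If [f] is [e 0], some other [h] in [F] through [v 1] takes its place on the path, and [e 0]
     becomes free. *)
  have [fe|] := eqVneq f (e 0); last exact: Fsub1.
  have [h] : exists h, h \in [set h in F :\ e 0 | v 1 \in h].
    apply/card_gt0P.
    have cF0 : 2 ^ w + 1 <= #|F :\ e 0| + w.
      by have := cardsD1 (e 0) F; case: (e 0 \in F) => /=; clia.
    have Fs g : g \in F :\ e 0 -> u \in g /\ g \subset u |: K.
      by rewrite in_setD1 => /andP[g0 gF]; split; [case: (FP g gF) | exact: Fsub1].
    by have := card_star_mem Fs v1K uK; rewrite cK; clia.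
  rewrite in_set in_setD1 => /andP[/andP[h0 hF] h1]; have [hE uh hf] := FP h hF.
  have hp' : hpath E L v (upd e 0 h).
    apply: hpath_upd => //.
  have [e0E _ _] := he 0 L_gt0.
  rewrite fe; apply: (free_sub_succs hp') => //; first by rewrite -fe.
  move=> k kL; rewrite /upd; case: eqP => [_ /eqP|k0 /ie H]; first by rewrite (negPf h0).
  by apply: k0; apply: H.
(* By [w <= 2 ^ w.-1], at least two members of [F] contain [x], so one differs from [h]. *)
have star1 x h : x \in K -> exists f, [/\ f \in F, f != h & x \in f].
  move=> xK; have := card_star_mem Fsub xK uK; rewrite cK.
  have := cardsD1 h [set f in F | x \in f].
  have [->|[f]] := set_0Vmem ([set f in F | x \in f] :\ h).
    by rewrite cards0; case: (_ \in _); rewrite /=; clia.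
  by rewrite in_setD1 in_set => /and3P[fh fF xf] _ _; exists f.
have star2 x z : x \in K -> z \in K -> x != z ->
    exists f, [/\ f \in F, x \in f & z \in f].
  move=> xK zK xz; have := card_star_mem2 Fsub xK zK xz uK; rewrite cK.
  have w2 : 1 < w.
    by rewrite -cK (cardsD1 x K) xK (cardsD1 z (K :\ x)) !inE eq_sym xz zK.
  have wexp2 : 2 ^ w.-1 = 2 ^ w.-2 + 2 ^ w.-2.
    by rewrite addnn -mul2n -expnS prednK //; lia.
  have := @ltn_expl 2 w.-2 isT.
  have [->|[f]] := set_0Vmem [set f in F | (x \in f) && (z \in f)].
    by rewrite cards0; clia.
  by rewrite in_set => /and3P[fF xf zf] _ _; exists f.
have Bsub i : 0 < i -> i < L -> u \in e i -> e i \subset u |: K.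
  move=> i0 iL ui; have [eE ei ei1] := he i iL.
  have i_neq0 : 0 <> i by move=> i0'; rewrite -i0' in i0.
  have eiF : e i \notin F by apply/negP => /FP[_ _ H]; apply: (H i iL) => // /esym.
  have viW := PW i iL ui.
  have vi1K : v i.+1 \in K by exact: mem_succs.
  have nv i' : i' < L -> i' <> i -> v i'.+1 != v i.+1.
    by move=> i'L ni; apply/eqP => /iv H; apply: ni; have [] := H i'L iL.
  have eni k : k < L -> k <> i -> e k <> e i by move=> kL ki /ie H; apply: ki; apply: H.
  (* Rerouting as v_0 -e_i- v_i ... v_1 -h- v_(i+1) ... v_L makes [v i] the second vertex. The set
     of successors of [W] turns out to be the same on the new path, and it contains the second
     vertex. *)
  have viK : v i \in K.
    have [h [hF h1 hi]] := star2 _ _ v1K vi1K (nv 0 L_gt0 i_neq0).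
    have [hE uh hf] := FP h hF.
    have [v' [v'0 v'L v'1 [e' [hp' e'P]]]] : exists v', [/\ v' 0 = u, v' L = v L,
      v' 1 = v i & exists e', hpath E L v' e' /\ forall f, f \in F -> f != h ->
        forall k, k < L -> e' k <> f].
      have eih : e i <> h by move=> eh; rewrite eh hF in eiF.
      have hpn : hpath E L _ _ :=
        hpath_inner hp (introT andP (conj i0 iL)) eE hE eih
          (fun k kL _ ki => eni k kL ki)
          (fun k kL k0 _ => hf k kL k0) ui ei h1 hi.
      exists (v \o (fun k => if 0 < k <= i then i.+1 - k else k)); split => //=.
      - by rewrite [L <= i]leqNgt iL andbF.
      - by rewrite i0 subn1.
      eexists; split; first exact: hpn.
      move=> f fF fh k kL; rewrite /upd /=; case: eqP => [_ /eqP|_]; first by rewrite eq_sym (negPf fh).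
      case: eqP => [_ eif|t0]; first by rewrite eif fF in eiF.
      have [_ _ H] := FP f fF; apply: H => //; clear -kL iL; case: ifP => ?; lia.
    have vL : v' L \notin W by rewrite v'L.
    (* Each [x] in [K] lies on an edge of [F] that is free for the new path; equality then follows
       since both sets have size [w]. *)
    have sub : K \subset succs v' W.
      apply/subsetP => x xK; have [f [fF fh xf]] := star1 x h xK.
      have [fE uf _] := FP f fF.
      have : x \in u |: succs v' W.
        apply: subsetP xf; rewrite -v'0 /W -v'L.
        by apply: (free_sub_succs hp') => //; [rewrite v'0 | exact: e'P].
      by rewrite in_setU1; case: eqP => // xu; rewrite xu (negPf uK) in xK.
    have -> : K = succs v' W.
      by apply/eqP; rewrite eqEcard sub cK (card_succs hp' vL) cW leqnn.
    have v'0W : v' 0 \in W by rewrite v'0.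
    by have := mem_succs L_gt0 v'0W; rewrite v'1.
  have nvi : v i != v i.+1.
    by apply/eqP => /iv H; have := H (ltnW iL) iL; clear; lia.
  (* Here [h] replaces [e i]. As [h] may be [e 0], a different edge [h1] through [v 1] takes
     position 0; then [e i] is free. *)
  have [h [hF hi hi1]] := star2 _ _ viK vi1K nvi.
  have [h1 [h1F h1h h1v]] := star1 (v 1) h v1K.
  have [hE uh hf] := FP h hF; have [h1E uh1 h1f] := FP h1 h1F.
  have hp0 : hpath E L v (upd e 0 h1) by exact: hpath_upd.
  have hp1 : hpath E L v (upd (upd e 0 h1) i h).
    apply: (hpath_upd hp0) => // k kL ki; rewrite /upd.
    by case: eqP => [_ /eqP|k0]; [rewrite (negPf h1h) | exact: hf].
  apply: (free_sub_succs hp1) => // k kL; rewrite /upd.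
  case: eqP => [_ he1|ki]; first by rewrite -he1 hF in eiF.
  case: eqP => [_ h1e|_]; first by rewrite -h1e h1F in eiF.
  exact: eni.
have : hdeg E u <= 2 ^ #|K|.
  apply: (@card_sandwich _ _ [set u]) => f; rewrite inE => /andP[fE uf].
  rewrite sub1set uf; split=> //.
  case fF: (f \in F); first by case: (Fsub f fF).
  have [k /andP[k0 kL] fk] := FC f fE uf (negbT fF).
  by rewrite fk; apply: Bsub; rewrite -?fk.
by rewrite cK leqNgt deg_gt.
Qed.
End DegreeBound.

(** * Codegrees *)

Definition codeg (T : finType) (E : hypergraph T) (x z : T) : nat :=
  #|[set f in E | (x \in f) && (z \in f)]|.

Lemma codegC (T : finType) (E : hypergraph T) x z : codeg E x z = codeg E z x.
Proof. by apply: eq_card => f; rewrite !inE [(x \in f) && _]andbC. Qed.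

Lemma hcycle_map (T : finType) (E1 E2 : hypergraph T) L (phi : {set T} -> {set T}) :
  {in E1 &, injective phi} ->
  (forall f, f \in E1 -> phi f \in E2 /\ f \subset phi f) ->
  hcycle E1 L -> hcycle E2 L.
Proof.
move=> iphi phiP [v [e [[iv ie he] [f [fE ef vf0 vf1]]]]].
exists v, (phi \o e); split; first split=> //=.
- move=> i j iL jL; have [[ei _ _] [ej _ _]] := (he i iL, he j jL).
  by move/iphi => h; apply: ie => //; exact: h.
- move=> i iL; have [ei vi vi1] := he i iL; have [eE /subsetP es] := phiP _ ei.
  by split; rewrite ?es.
have [fE2 /subsetP fs] := phiP _ fE.
exists (phi f); split; rewrite ?fs //= => i iL; have [ei _ _] := he i iL.
by move/iphi => h; apply: (ef i iL); exact: h.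
Qed.

(** Where a cycle uses [g], the larger [f] can stand in, and no other edge of the cycle equals
    [f]. *)
Lemma hcycle_shrink (T : finType) (E : hypergraph T) L (f g : {set T}) :
  f \in E -> g \subset f -> hcycle (g |: (E :\ f)) L -> hcycle E L.
Proof.
move=> fE gf; apply: (@hcycle_map _ _ _ _ (fun h => if h == g then f else h)).
  move=> h1 h2; rewrite !in_setU1 !in_setD1.
  have [->|_] := eqVneq h1 g; have [->|_] := eqVneq h2 g => //=.
    by move=> _ /andP[/eqP h2f _] /esym.
  by move=> /andP[/eqP h1f _] _.
move=> h; rewrite in_setU1 in_setD1; case: eqP => [->//|_] /=.
by case/andP.
Qed.

Section Adjacency.
Variables (T : finType) (E : hypergraph T) (L : nat).
Hypothesis cardT : #|T| = L.+1.
Implicit Types (v : nat -> T) (e : nat -> {set T}) (A C D : {set T}).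

Lemma fresh_edge e x z : L < codeg E x z ->
  exists f, [/\ f \in E, x \in f, z \in f & forall k, k < L -> e k <> f].
Proof.
move=> cLt; pose Q := [set e (val k) | k in 'I_L].
have [f] : exists f, f \in [set f in E | (x \in f) && (z \in f)] :\: Q.
  apply/card_gt0P; rewrite cardsD subn_gt0; apply: leq_ltn_trans cLt.
  apply: leq_trans (subset_leq_card (subsetIr _ _)) _.
  by apply: leq_trans (leq_imset_card _ _) _; rewrite card_ord.
rewrite in_setD in_set => /andP[fQ /and3P[fE xf zf]]; exists f; split=> // k kL ef.
by case/negP: fQ; apply/imsetP; exists (Ordinal kL); rewrite //= ef.
Qed.

Lemma codeg_notin_ends x y : ~ hcycle E L -> L < codeg E x y -> x \notin ends E L y.
Proof.
move=> nh /fresh_edge cd; apply/negP => /ends_path[v [e [hp v0 vL]]].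
have [f [fE xf yf ef]] := cd e; apply: nh; exists v, e; split=> //.
by exists f; rewrite v0 vL.
Qed.

(* The threshold leaves an edge outside any path even after one edge is deleted. *)
Definition nbr x : {set T} := [set z | (z != x) && (L.+1 < codeg E x z)].

(** Double counting: such an edge contains some [z] outside [x |: nbr x]; there are at most [L.+1]
    such [z], each of codegree at most [L.+1] with [x]. *)
Lemma card_escape x :
  #|[set f in E | (x \in f) && ~~ (f \subset x |: nbr x)]| <= L.+1 * L.+1.
Proof.
rewrite -sum1_card.
apply: (@leq_trans (\sum_(z in ~: (x |: nbr x)) codeg E x z)).
  rewrite /codeg; under [X in _ <= X]eq_bigr do rewrite -sum1_card.
  rewrite (exchange_big_dep (mem [set f in E | x \in f])) /=; last first.
    by move=> z f _; rewrite !inE => /and3P[-> ->].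
  rewrite big_mkcond [X in _ <= X]big_mkcond /=; apply: leq_sum => f _.
  rewrite !inE; case: ifP => // /and3P[fE xf /subsetPn[z zf zn]].
  by rewrite fE xf (bigD1 z) /= ?inE ?fE ?xf ?zf ?andbT /= ?andbT; move: zn; rewrite !inE.
apply: (@leq_trans (\sum_(z in ~: (x |: nbr x)) L.+1)).
  apply: leq_sum => z; rewrite !inE negb_or negb_and.
  by case: (z == x) => //=; rewrite -leqNgt.
by rewrite sum_nat_const leq_mul2r -cardT max_card orbT.
Qed.

Lemma hdeg_split x A : hdeg E x =
  #|[set f in E | (x \in f) && (f \subset A)]|
  + #|[set f in E | (x \in f) && ~~ (f \subset A)]|.
Proof.
rewrite /hdeg -(cardsID [set f : {set T} | f \subset A] [set f in E | x \in f]).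
by congr (_ + _); apply: eq_card => f; rewrite !inE;
  case: (f \in E); case: (x \in f); case: (f \subset A).
Qed.

Lemma card_inner x : #|[set f in E | (x \in f) && (f \subset x |: nbr x)]| <= 2 ^ #|nbr x|.
Proof.
apply: (@card_sandwich _ _ [set x]) => f; rewrite inE => /and3P[_ xf fs].
by rewrite sub1set.
Qed.

Lemma hdeg_le_nbr x : hdeg E x <= 2 ^ #|nbr x| + L.+1 * L.+1.
Proof. by rewrite (hdeg_split x (x |: nbr x)) leq_add ?card_inner ?card_escape. Qed.

(** All but at most (L+1)^2 edges at [u] lie in [u |: nbr u]. For [x] and [z] in [nbr u], at most
    2^(m-1) + 2^(m-2) of those miss [x] or [z], so more than [L] contain both. *)
Lemma codeg_clique u x z m : #|nbr u| = m -> 2 ^ m < hdeg E u ->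
  L.+1 * L.+1 + L < 2 ^ m.-2 -> 1 < m ->
  x \in u |: nbr u -> z \in u |: nbr u -> x != z -> L < codeg E x z.
Proof.
move=> cm dm Lm m2; have nb w : w \in nbr u -> L < codeg E u w.
  by rewrite inE => /andP[_]; exact: ltnW.
have un : u \notin nbr u by rewrite inE eqxx.
rewrite !in_setU1; have [->|_] := eqVneq x u.
  have [->|_] := eqVneq z u => //.
  by move=> _ /nb.
have [-> /= /nb + _ _|_ /= xn zn xz] := eqVneq z u; first by rewrite codegC.
have Fs f : f \in [set f in E | (u \in f) && (f \subset u |: nbr u)] ->
    u \in f /\ f \subset u |: nbr u by rewrite inE => /and3P[].
have := card_star_mem2 Fs xn zn xz un; rewrite cm => h1.
have h2 := card_escape u; have h3 := hdeg_split u (u |: nbr u).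
have h4 : #|[set f in [set f in E | (u \in f) && (f \subset u |: nbr u)]
    | (x \in f) && (z \in f)]| <= codeg E x z.
  apply/subset_leq_card/subsetP => f; rewrite !inE.
  by case/andP => /and3P[-> _ _].
have e1 : 2 ^ m = 2 ^ m.-1 + 2 ^ m.-1.
  by rewrite addnn -mul2n -expnS prednK //; lia.
have e2 : 2 ^ m.-1 = 2 ^ m.-2 + 2 ^ m.-2.
  by rewrite addnn -mul2n -expnS prednK //; lia.
move: (L.+1 * L.+1) Lm h2 => q Lm h2; clia.
Qed.

End Adjacency.

(** * Crossing the two cliques *)

Section Crossing.
Variables (T : finType) (E : hypergraph T) (L : nat).
Hypothesis cardT : #|T| = L.+1.
Implicit Types (v : nat -> T) (e : nat -> {set T}) (A C D : {set T}).

(** As [v L] is in [D], exactly [#|C|] steps start outside [D]. As [v 0] is in [C], exactly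
    [#|C| - 1] steps end in [C], and all of these start outside [D]. *)
Lemma crossing_unique v e C D : hpath E L v e ->
  v 0 \in C -> v L \in D -> #|~: D| = #|C| ->
  (forall k, k < L -> v k.+1 \in C -> v k \notin D) ->
  #|[set k : 'I_L | (v k \notin D) && (v k.+1 \notin C)]| = 1.
Proof.
move=> hp v0C vLD cDC CD.
have h1 := card_pred_idx cardT (~: D) hp.
have h2 := card_succ_idx cardT C hp.
rewrite (cardsD1 (v 0) C) v0C -h2 in cDC.
have e1 : (~: D) :\ v L = ~: D.
  by apply/setP => x; rewrite !inE; case: eqVneq => //= ->; rewrite vLD.
rewrite e1 cDC in h1.
rewrite -(cardsID [set k : 'I_L | v k.+1 \in C]) in h1.
have e2 : [set k : 'I_L | v k \in ~: D] :&: [set k : 'I_L | v k.+1 \in C]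
    = [set k : 'I_L | v k.+1 \in C].
  by apply/setIidPr/subsetP => k; rewrite !inE => /(CD k (ltn_ord k)).
have e3 : [set k : 'I_L | v k \in ~: D] :\: [set k : 'I_L | v k.+1 \in C]
    = [set k : 'I_L | (v k \notin D) && (v k.+1 \notin C)].
  by apply/setP => k; rewrite !inE andbC.
rewrite e2 e3 addnC in h1; exact: addIn h1.
Qed.

(** An edge at [v 0] that leaves [C] and sits away from the unique crossing allows reroutings that
    locate this crossing. *)
Lemma crossing_exit v e C D :
  hpath E L v e -> #|~: D| = #|C| -> v 0 \in C -> v L \in D ->
  ends E L (v L) = ~: D ->
  (forall x z, x \in C -> z \in C -> x != z -> L < codeg E x z) ->
  1 < #|[set f in E | (v 0 \in f) && ~~ (f \subset C)]| ->
  (forall v' e', hpath E L v' e' -> v' 0 = v 0 -> v' L = v L ->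
     forall f, f \in E -> v 0 \in f -> ~~ (f \subset C) ->
     exists2 k, k < L & e' k = f) ->
  (forall k, k < L -> v k.+1 \in C -> v k \notin D) /\
  exists2 c, c < L & [/\ v c \in C, v c \notin D, v c.+1 \notin C & v c.+1 \notin D].
Proof.
move=> hp cDC v0C vLD eD strong esc used; have [iv ie he] := hp.
have CD k : k < L -> v k.+1 \in C -> v k \notin D.
  move=> kL vk; rewrite -in_setC -eD.
  have n0 : v 0 != v k.+1 by apply/eqP => /iv h; have := h isT kL.
  have [f [fE f0 f1 ff]] := fresh_edge e (strong _ _ v0C vk n0).
  by apply: (rot_ends hp kL fE) => // j jL _; exact: ff.
split=> //; have /eqP/cards1P[c cE] := crossing_unique hp v0C vLD cDC CD.
have v0D : v 0 \notin D by rewrite -in_setC -eD; exact: mem_ends hp.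
have /card_gt1P[f1 [f2 [f1P f2P f12]]] := esc.
(* At most one of the two edges leaving [C] occupies the crossing position [c]; the other one serves
   as [e i]. *)
have : exists2 i, i < L & [/\ v 0 \in e i, ~~ (e i \subset C) & (v i \in D) || (v i.+1 \in C)].
  move: f1P f2P; rewrite !inE => /and3P[f1E f10 f1C] /and3P[f2E f20 f2C].
  have [k1 k1L ek1] := used _ _ hp erefl erefl f1 f1E f10 f1C.
  have [k2 k2L ek2] := used _ _ hp erefl erefl f2 f2E f20 f2C.
  have ce k (kL : k < L) : (v k \in D) || (v k.+1 \in C) \/ k = c :> nat.
    case h : (_ || _); [by left | right]; move/negbT: h; rewrite negb_or => h.
    have : Ordinal kL \in [set c] by rewrite -cE inE.
    by rewrite inE => /eqP <-.
  case: (ce k1 k1L) => [h|k1c]; first by exists k1; rewrite ?ek1.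
  case: (ce k2 k2L) => [h|k2c]; first by exists k2; rewrite ?ek2.
  by move/eqP: f12; rewrite -ek1 -ek2 k1c k2c.
case=> i iL [v0ei eiC]; have [eiE vi vi1] := he i iL.
have viD : v i \notin D.
  rewrite -in_setC -eD; apply: (rot_ends hp iL eiE) => // j jL ji /ie h.
  by apply: ji; exact: h.
rewrite (negPf viD) /= => vi1C.
have neq k : k < L -> k <= i -> v k != v i.+1.
  move=> kL ki; apply/eqP => /iv h; have := h (ltnW kL) iL.
  by move=> kE; rewrite kE ltnn in ki.
have viC : v i \notin C.
  apply/negP => viC.
  have [h [hE h0 h1 hf]] := fresh_edge e (strong _ _ viC vi1C (neq i iL (leqnn i))).
  have hp' : hpath E L v (upd e i h) by apply: hpath_upd => // k kL _; exact: hf.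
  have [k kL] := used _ _ hp' erefl erefl _ eiE v0ei eiC.
  rewrite /upd; case: eqP => [_ he'|ki /ie h']; first exact: (hf i iL (esym he')).
  by apply: ki; apply: h'.
(* At step [l] the path first leaves [C :\: D]; this happens no later than position [i], as [v i] is
   not in [C]. *)
have ex : exists l, (l < i) && ((v l.+1 \notin C) || (v l.+1 \in D)).
  exists i.-1; have i0 : 0 < i by rewrite lt0n; apply: contraNneq viC => ->.
  by rewrite prednK // leqnn viC.
have [l /andP[li vl1] lmin] := ex_minnP ex.
have lL : l < L by exact: ltn_trans li iL.
have [vlC vlD] : v l \in C /\ v l \notin D.
  case: l li vl1 lmin lL => [|l] // li _ lmin _.
  have : ~~ ((l < i) && ((v l.+1 \notin C) || (v l.+1 \in D))).
    by apply/negP => /lmin; rewrite ltnn.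
  by rewrite (ltnW li) /= negb_or negbK => /andP[].
have vl1D : v l.+1 \notin D.
  apply/negP => vlD1.
  have [h [hE h0 h1 hf]] := fresh_edge e (strong _ _ vlC vi1C (neq l lL (ltnW li))).
  have := mem_ends (@hpath_swap _ E L v e l i h hp _ hE _ v0ei h0 h1).
  rewrite li iL => /(_ isT) H.
  have {H} := H (fun k kL _ => hf k kL).
  rewrite /= subn_gt0 li addn0.
  have -> : (L < i - l) = false by clear -iL; lia.
  by rewrite [L <= i]leqNgt iL /= eD inE vlD1.
exists l => //; split=> //; move: vl1; rewrite (negPf vl1D) orbF //.
Qed.

End Crossing.

Lemma escape_used (T : finType) (E : hypergraph T) L m v e (f : {set T}) :
  #|T| = L.+1 -> 1 < L -> L = m.*2.+1 -> ~ hcycle E L -> hpath E L v e ->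
  m <= #|nbr E L (v 0)| -> 2 ^ m + 1 < hdeg E (v L) ->
  f \in E -> v 0 \in f -> ~~ (f \subset v 0 |: nbr E L (v 0)) ->
  exists2 k, k < L & e k = f.
Proof.
move=> cardT L1 Lm nh hp cn dy fE uf /subsetPn[z zf zC].
have [//|nf] := pselect (exists2 k, k < L & e k = f); exfalso.
have {}nf k : k < L -> e k <> f by move=> kL ef; apply: nf; exists k.
have uz : z != v 0 by apply: contraNneq zC => ->; rewrite setU11.
pose g := [set v 0; z]; pose E' := g |: (E :\ f).
have gf : g \subset f by rewrite subUset !sub1set uf zf.
have nh' : ~ hcycle E' L by move/(hcycle_shrink fE gf).
(* Losing [f] costs at most one, which the threshold in [nbr] absorbs. *)
have codegE x w : codeg E x w <= (codeg E' x w).+1.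
  rewrite /codeg (cardsD1 f) -addn1 addnC leq_add ?leq_b1 //.
  apply/subset_leq_card/subsetP => h; rewrite !inE.
  by case/and4P => -> -> -> ->; rewrite orbT.
have hp' : hpath E' L v e.
  case: hp => iv ie he; split=> // i iL; have [eE e0 e1] := he i iL; split=> //.
  by rewrite in_setU1 in_setD1 eE andbT orbC; case: eqP (nf i iL).
have := hdeg_le_ends cardT (ltnW L1) (hpath_rev hp'); rewrite subn0 subnn.
have dE : hdeg E (v L) <= (hdeg E' (v L)).+1.
  rewrite /hdeg (cardsD1 f) -addn1 addnC leq_add ?leq_b1 //.
  apply/subset_leq_card/subsetP => h; rewrite !inE.
  by case/and3P => -> -> ->; rewrite orbT.
have cends : #|ends E' L (v 0)| <= m.
  have : ends E' L (v 0) \subset ~: (z |: (v 0 |: nbr E L (v 0))).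
    apply/subsetP => x xe; rewrite in_setC in_setU1 in_setU1 !negb_or; apply/and3P; split.
    - apply/eqP => xz; rewrite xz in xe.
      have [v' [e' [hp2 v'0 v'L]]] := ends_path xe.
      apply: nh'; exists v', e'; split=> //; exists g.
      split; rewrite ?v'0 ?v'L ?setU11 ?inE ?eqxx ?orbT // => k kL ek.
      (* The pair [g] is not on the path: it consists of the first and last vertices, which are not
         consecutive as [1 < L]. *)
      have [iv _ he] := hp2; have [_] := he k kL; rewrite ek !inE -v'0 -v'L.
      have idx a b : v' a == v' b -> a <= L -> b <= L -> a = b.
        by move=> /eqP vab aL bL; exact: iv.
      case/orP => /idx h1 /orP[] /idx h2; have {}h1 := h1 (ltnW kL);
        have {}h2 := h2 kL; clear -kL L1 h1 h2; lia.
    - by apply: contraTneq xe => ->; exact: ends_irr (ltnW L1).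
    apply: contraTN xe => xn; apply: codeg_notin_ends => //.
    rewrite codegC -ltnS; apply: leq_trans (codegE _ _).
    by move: xn; rewrite inE => /andP[].
  move/subset_leq_card; have := cardsC (z |: (v 0 |: nbr E L (v 0))).
  rewrite !cardsU1 zC cardT inE eqxx /=.
  move: cn Lm; clear; clia.
have : 2 ^ #|ends E' L (v 0)| <= 2 ^ m by rewrite leq_exp2l.
move: dE dy; clear; clia.
Qed.

(** * Saturation *)

Section Saturation.
Variables (T : finType) (L : nat).
Hypotheses (cardT : #|T| = L.+1) (L_gt1 : 1 < L).
Implicit Types (E : hypergraph T) (v : nat -> T) (e : nat -> {set T}).

Lemma hcycle_hamiltonian E : hcycle E L -> has_hamiltonian_berge_cycle E.
Proof.
case=> v [e [hp [f [fE ef vLf v0f]]]]; have [iv ie he] := hp.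
have oe (i : 'I_L.+1) : i = L :> nat \/ i < L.
  by have := ltn_ord i; rewrite ltnS leq_eqVlt => /predU1P.
exists L.+1, (fun i : 'I_L.+1 => v i), (fun i : 'I_L.+1 => upd e L f i); split; first split.
- by move=> i j /iv h; apply/val_inj/h; rewrite -ltnS ltn_ord.
- move=> i j; rewrite /upd => h; apply/val_inj; move: h => /=.
  case: (oe i) => [->|iL]; case: (oe j) => [->|jL] //; rewrite ?eqxx ?ltn_eqF //.
  + by move/esym/(ef j jL).
  + by move/(ef i iL).
  + by move/ie; apply.
- move=> i; rewrite /upd; case: (oe i) => [->|iL]; first by rewrite eqxx.
  by rewrite ltn_eqF //; case: (he _ iL).
- move=> i; rewrite /upd; case: (oe i) => [->|iL]; first by rewrite eqxx.
  by rewrite ltn_eqF //; case: (he _ iL).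
- move=> i; rewrite /upd /=; case: (oe i) => [->|iL]; first by rewrite eqxx modnn.
  by rewrite ltn_eqF // modn_small //; case: (he _ iL).
split; first by rewrite cardT.
by move=> x; have [j jL vj] := hpath_surj cardT x hp; exists (Ordinal (jL : j < L.+1)).
Qed.

Lemma pair_inj v i j k l : (forall a b, a <= L -> b <= L -> v a = v b -> a = b) ->
  i <= L -> j <= L -> k <= L -> l <= L ->
  [set v i; v j] = [set v k; v l] -> (i = k /\ j = l) \/ (i = l /\ j = k) \/ i = j.
Proof.
move=> iv iL jL kL lL /setP eq.
have /esym := eq (v i); have /esym := eq (v j); rewrite !inE !eqxx ?orbT.
move=> /orP[] /eqP/iv h1 /orP[] /eqP/iv h2.
- have := h1 jL kL; have := h2 iL kL; lia.
- have := h1 jL kL; have := h2 iL lL; lia.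
- have := h1 jL lL; have := h2 iL kL; lia.
- have := h1 jL lL; have := h2 iL lL; lia.
Qed.

Lemma hcycle_pairs E : (forall x z, x != z -> [set x; z] \in E) -> hcycle E L.
Proof.
move=> pE; have x0 : T by apply: (@enum_val _ T); rewrite cardT; exact: ord0.
pose v k := nth x0 (enum T) k.
have iv a b : a <= L -> b <= L -> v a = v b -> a = b.
  move=> aL bL /eqP; rewrite nth_uniq ?enum_uniq -?cardE ?cardT //.
  by move/eqP.
have pv i j : i <= L -> j <= L -> i != j -> [set v i; v j] \in E.
  by move=> iL jL ij; apply: pE; apply: contra ij => /eqP/iv ->.
exists v, (fun k => [set v k; v k.+1]); split.
  split=> //.
    move=> i j iL jL eq.
    have := pair_inj iv (ltnW iL) iL (ltnW jL) jL eq; lia.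
  by move=> i iL; rewrite !inE !eqxx orbT; split=> //; apply: pv => //; lia.
exists [set v L; v 0]; rewrite !inE !eqxx orbT; split=> //; first by apply: pv => //; lia.
move=> i iL eq; have := pair_inj iv (ltnW iL) iL (leqnn L) (leq0n L) eq; lia.
Qed.

(** The cycle must use [g]; deleting [g] from it leaves the path. *)
Lemma hcycle_cut E (g : {set T}) : ~ hcycle E L -> hcycle (g |: E) L ->
  exists v e, hpath E L v e.
Proof.
move=> nh [v [e [[iv ie he] [f [fE ef vLf v0f]]]]].
have [fg|fg] := eqVneq f g.
  exists v, e; split=> // i iL; have [eE ei ei1] := he i iL; split=> //.
  move: eE; rewrite in_setU1; case: eqP => // eg; case: (ef i iL); by rewrite eg fg.
have [[k kL ek]|ne] := pselect (exists2 k, k < L & e k = g); last first.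
  case: nh; exists v, e; split.
    split=> // i iL; have [eE ei ei1] := he i iL; split=> //.
    by move: eE; rewrite in_setU1; case: eqP => // eg; case: ne; exists i.
  exists f; split=> //; by move: fE; rewrite in_setU1 (negPf fg).
(* [s j] is j + k + 1 modulo L + 1, so the path starts just after the deleted edge; [c] lists the
   cycle's edges with [f] at position [L]. *)
pose s j := if j + k.+1 <= L then j + k.+1 else j + k - L.
pose c j := upd e L f j.
have ic a b : a <= L -> b <= L -> c a = c b -> a = b.
  rewrite /c /upd => aL bL.
  case: eqP => [->|na]; case: eqP => [->|nb] //.
  + by move/esym/ef => h; case: h; lia.
  + by move/ef => h; case: h; lia.
  + by move/ie; apply; lia.
have sL j : j <= L -> s j <= L by rewrite /s; case: ifP; lia.
have si a b : a <= L -> b <= L -> s a = s b -> a = b.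
  by rewrite /s; case: ifP => ?; case: ifP => ?; lia.
have sk j : j < L -> s j <> k by rewrite /s; case: ifP; lia.
exists (v \o s), (c \o s); split=> /=.
- move=> i j iL jL /iv h; apply: si => //; apply: h; exact: sL.
- move=> i j iL jL /ic h; apply: si; rewrite ?(ltnW iL) ?(ltnW jL) //.
  by apply: h; apply: sL; exact: ltnW.
move=> i iL.
have cE : c (s i) \in E.
  have ck : c k = g by rewrite /c /upd ltn_eqF.
  have : c (s i) \in g |: E.
    rewrite /c /upd; case: eqP => // sn; have := sL i (ltnW iL) => sl.
    by case: (he (s i)) => //; lia.
  rewrite in_setU1; case: eqP => // /esym; rewrite -ck => /ic h.
  by case: (sk i iL); apply/esym/h; [exact: ltnW | exact: sL (ltnW iL)].
have [sE|sE] : s i = L /\ s i.+1 = 0 \/ s i < L /\ s i.+1 = (s i).+1.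
- by rewrite /s; case: ifP => ?; case: ifP => ?; lia.
- by case: sE => sE si1; split=> //; rewrite /c /upd ?si1 sE eqxx.
case: sE => sE si1; split=> //; rewrite /c /upd ?si1 ltn_eqF //; by case: (he _ sE).
Qed.

(** Missing pairs are added until the next one would create a Hamiltonian cycle; cutting that cycle
    gives the path. The process stops because all pairs together contain a Hamiltonian cycle. *)
Lemma saturate E : ~ hcycle E L -> exists E' : hypergraph T,
  [/\ E \subset E', ~ hcycle E' L & exists v e, hpath E' L v e].
Proof.
have [n] := ubnP #|~: E|; elim: n => // n IH in E * => cE nh.
have [pE|] := pselect (forall x z, x != z -> [set x; z] \in E).
  by case: nh; exact: hcycle_pairs.
move=> /existsNP[x /existsNP[z /not_implyP[xz /negP gE]]].
have [hg|nhg] := pselect (hcycle ([set x; z] |: E) L).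
  by exists E; split=> //; exact: hcycle_cut nh hg.
have [|E' [sub nh' ex]] := IH ([set x; z] |: E) _ nhg; last first.
  by exists E'; split=> //; apply: subset_trans sub; exact: subsetUr.
rewrite -ltnS; apply: leq_trans cE; rewrite ltnS; apply/proper_card.
rewrite properE setCS subsetUr /=; apply/subsetPn; exists [set x; z].
  by rewrite inE.
by rewrite inE negbK setU11.
Qed.

End Saturation.

(** * Degree sequences and a numerical estimate *)

Lemma hdegS (T : finType) (E E' : hypergraph T) x : E \subset E' -> hdeg E x <= hdeg E' x.
Proof.
move=> /subsetP sub; apply/subset_leq_card/subsetP => f; rewrite !inE.
by case/andP => /sub -> ->.
Qed.

(** Otherwise at least [i] degrees are at most [p], hence so is the i-th smallest. In this form,
    about sets of vertices, the degree conditions visibly survive the addition of edges. *)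
Lemma sdeg_ex (T : finType) (E : hypergraph T) i p (X : {set T}) :
  0 < i -> i <= #|X| -> p < sdeg E i -> exists2 x, x \in X & p < hdeg E x.
Proof.
move=> i0 iX pi; apply/exists_inP; apply: contraLR pi; rewrite negb_exists_in -leqNgt.
move/forall_inP => Xp; rewrite /sdeg; set s := sorted_degrees E.
have ss : sorted leq s by apply: sort_sorted; exact: leq_total.
have [szi|] := leqP (size s) i.-1; first by rewrite nth_default.
move=> isz; rewrite leqNgt; apply/negP => pn.
have c1 : #|X| <= count (fun d => d <= p) s.
  rewrite (permP (permEl (perm_sort _ _))) count_map.
  rewrite -size_filter.
  have -> : #|X| = size (filter (mem X) (enum T)).
    by rewrite cardE /enum_mem -filter_predI; congr size; apply: eq_filter => x; rewrite /= andbT.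
  rewrite !size_filter; apply: sub_count => x /= /Xp; by rewrite -leqNgt.
have c2 : count (fun d => d <= p) s <= i.-1.
  rewrite -[X in count _ X](cat_take_drop i.-1) count_cat.
  have -> : count (fun d => d <= p) (drop i.-1 s) = 0.
    apply/eqP; rewrite -leqn0 leqNgt -has_count -all_predC; apply/(all_nthP 0) => k.
    rewrite size_drop => kk; rewrite nth_drop /= -ltnNge; apply: leq_trans pn _.
    apply: (sorted_leq_nth leq_trans leqnn) => //; rewrite ?inE ?leq_addr //; lia.
  rewrite addn0; apply: leq_trans (count_size _ _) _.
  by rewrite size_take; case: ifP => //; lia.
lia.
Qed.

(** Induction from m = 20, where 42^2 + 41 = 1805 < 2^18; the assumption n > 40 supplies
    [20 <= m]. *)
Lemma quadratic_lt_expn m L : 20 <= m -> L <= m.*2.+1 ->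
  L.+1 * L.+1 + L < 2 ^ m.-2.
Proof.
move=> m20 Lm; apply: (@leq_ltn_trans (m.*2.+2 * m.*2.+2 + m.*2.+1)).
  by rewrite leq_add // leq_mul.
have [k ->] : exists k, m = k + 20 by exists (m - 20); rewrite subnK.
have -> : (k + 20).-2 = k + 18 by lia.
have -> : (k + 20).*2.+2 * (k + 20).*2.+2 + (k + 20).*2.+1 = 4 * (k * k) + 170 * k + 1805 by lia.
elim: k => [|k IH]; last by rewrite addSn expnS; lia.
by rewrite add0n (_ : 18 = 9 + 9) // expnD.
Qed.

(** * The extremal pair of ends *)

Section Endgame.
Variables (T : finType) (E : hypergraph T) (L m : nat).
Hypotheses (cardT : #|T| = L.+1) (m_ge20 : 20 <= m) (Lm : L <= m.*2.+1) (mL : m.*2 <= L).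
Hypothesis nh : ~ hcycle E L.

Lemma expn_half : 2 ^ m = 2 ^ m.-1 + 2 ^ m.-1 /\ 2 ^ m.-1 = 2 ^ m.-2 + 2 ^ m.-2.
Proof. by rewrite !addnn -!mul2n -!expnS !prednK //; lia. Qed.

(** With fewer than [m] neighbours the degree is at most 2^(m-1) + (L+1)^2, less than 2^m. *)
Lemma card_nbr_ge x : 2 ^ m < hdeg E x -> m <= #|nbr E L x|.
Proof.
move=> dx; rewrite leqNgt; apply/negP => nm.
have h1 := hdeg_le_nbr E cardT x; have h2 := quadratic_lt_expn m_ge20 Lm.
have h3 : 2 ^ #|nbr E L x| <= 2 ^ m.-1 by rewrite leq_exp2l //; lia.
have [e1 e2] := expn_half.
move: (L.+1 * L.+1) h1 h2 => q; clear -dx h3 e1 e2; lia.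
Qed.

Lemma ends_sub_nbr y : ends E L y \subset ~: (y |: nbr E L y).
Proof.
apply/subsetP => x xe; rewrite in_setC in_setU1 negb_or; apply/andP; split.
  by apply: contraTneq xe => ->; apply: ends_irr; lia.
apply: contraTN xe => xn; apply: codeg_notin_ends => //.
by rewrite codegC; move: xn; rewrite inE => /andP[_]; exact: ltnW.
Qed.

Lemma card_compl_nbr y : #|~: (y |: nbr E L y)| + #|nbr E L y| = L.
Proof.
have := cardsC (y |: nbr E L y); rewrite cardsU1 inE eqxx /= cardT; lia.
Qed.

(** At least [m] neighbours and more than [m] ends must fit into [L] vertices besides [y], and L <=
    2m + 1 makes everything tight. *)
Lemma ends_nbr y : 2 ^ m < hdeg E y -> m < #|ends E L y| ->
  [/\ L = m.*2.+1, #|nbr E L y| = m & ends E L y = ~: (y |: nbr E L y)].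
Proof.
move=> dy we; have n1 := card_nbr_ge dy; have n2 := card_compl_nbr y.
have n3 := subset_leq_card (ends_sub_nbr y).
split; [lia | lia |].
by apply/eqP; rewrite eqEcard ends_sub_nbr; lia.
Qed.

Lemma one_sided_exit v e : hpath E L v e -> L = m.*2.+1 ->
  #|nbr E L (v 0)| = m -> #|nbr E L (v L)| = m ->
  ends E L (v L) = ~: (v L |: nbr E L (v L)) ->
  2 ^ m + 1 < hdeg E (v 0) -> 2 ^ m + 1 < hdeg E (v L) ->
  let C := v 0 |: nbr E L (v 0) in let D := v L |: nbr E L (v L) in
  #|~: D| = #|C| /\ (forall k, k < L -> v k.+1 \in C -> v k \notin D) /\
  exists2 c, c < L & [/\ v c \in C, v c \notin D, v c.+1 \notin C & v c.+1 \notin D].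
Proof.
move=> hp Lm1 nu ny eD du dy C D.
have cDC : #|~: D| = #|C|.
  have := card_compl_nbr (v L); rewrite -/D /C cardsU1 inE eqxx nu ny /=; lia.
split=> //; apply: (crossing_exit cardT hp) => //; rewrite ?setU11 //.
- move=> x z xC zC; apply: (codeg_clique cardT nu) => //; try lia.
  exact: quadratic_lt_expn.
(* At most 2^m edges at [v 0] lie in [C], so at least two leave it. *)
- have := hdeg_split E (v 0) C; have := card_inner E L (v 0); rewrite nu -/C.
  clear -du; lia.
move=> v' e' hp' v0 vL f fE f0 fC; apply: (@escape_used _ E L m v' e' f) => //; rewrite ?v0 ?vL //; lia.
Qed.

(** The path gives a crossing that starts in [C]; its reversal gives one that starts outside [C]. By
    uniqueness they coincide. *)
Lemma no_extremal_pair u y : u \in ends E L y -> L = m.*2.+1 ->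
  #|nbr E L u| = m -> #|nbr E L y| = m ->
  ends E L u = ~: (u |: nbr E L u) -> ends E L y = ~: (y |: nbr E L y) ->
  2 ^ m + 1 < hdeg E u -> 2 ^ m + 1 < hdeg E y -> False.
Proof.
case/ends_path => v [e [hp <- <-]] Lm1 nu ny eu ey du dy.
have [cDC [CD [c cL [cC cD c1C c1D]]]] := one_sided_exit hp Lm1 nu ny ey du dy.
have := one_sided_exit (hpath_rev hp) Lm1; rewrite subn0 subnn.
move=> /(_ ny nu eu dy du) [_ [_ [b bL [_ bC b1D b1C]]]].
have /eqP/cards1P[k kE] :=
  crossing_unique cardT hp (setU11 _ _) (setU11 _ _) cDC CD.
have : Ordinal cL \in [set k] by rewrite -kE inE /= cD.
have b'L : L - b.+1 < L by lia.
have : Ordinal b'L \in [set k].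
  rewrite -kE inE /= b1D /=.
  by have -> : (L - b.+1).+1 = L - b by lia.
rewrite !inE => /eqP <- /eqP [cb].
by case/negP: b1C; rewrite -cb.
Qed.

Lemma hcycle_of_degrees : (exists v e, hpath E L v e) ->
  (forall i (X : {set T}), 0 < i <= m -> i <= #|X| -> exists2 x, x \in X & 2 ^ i < hdeg E x) ->
  (L = m.*2.+1 -> forall X : {set T}, m <= #|X| -> exists2 x, x \in X & 2 ^ m + 1 < hdeg E x) ->
  False.
Proof.
move=> [v [e hp]] condA condB.
have [u [y [uy duy umax]]] : exists u y, [/\ u \in ends E L y, hdeg E u <= hdeg E y
    & forall x, x \in ends E L y -> hdeg E x <= hdeg E u].
  pose P (p : T * T) := p.1 \in ends E L p.2.
  have P0 : P (v 0, v L) by exact: mem_ends hp.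
  case: (@arg_maxnP _ (v 0, v L) P (fun p => hdeg E p.1 + hdeg E p.2) P0) => -[a b] ab ab_max.
  have [dab|dba] := leqP (hdeg E a) (hdeg E b).
    exists a, b; split=> // x xb; have := ab_max (x, b) xb; rewrite /= leq_add2r //.
  exists b, a; split; [exact: ends_sym | exact: ltnW |] => x xa.
  by have := ab_max (a, x) (ends_sym xa); rewrite /= leq_add2l.
have L0 : 0 < L by lia.
have main a b : a \in ends E L b -> hdeg E a <= 2 ^ #|ends E L b|.
  by case/ends_path => v' [e' [hp' <- <-]]; exact: (hdeg_le_ends cardT L0 hp').
(* Otherwise some [x] in W has degree above 2^|W|, hence above that of [u], against [umax]. *)
have wm : m < #|ends E L y|.
  rewrite ltnNge; apply/negP => wm; have w0 : 0 < #|ends E L y| by apply/card_gt0P; exists u.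
  have [|x xW] := condA _ _ _ (leqnn #|ends E L y|); first by rewrite w0.
  by rewrite ltnNge => /negP; apply; apply: leq_trans (umax x xW) (main _ _ uy).
have du : 2 ^ m < hdeg E u.
  have [|x xW dx] := condA m _ _ (ltnW wm); first by lia.
  exact: leq_trans dx (umax x xW).
have dy := leq_trans du duy.
have [Lm1 ny ey] := ends_nbr dy wm.
have wm' : m < #|ends E L u|.
  have := leq_trans dy (main _ _ (ends_sym uy)); by rewrite ltn_exp2l.
have [_ nu eu] := ends_nbr du wm'.
have du1 : 2 ^ m + 1 < hdeg E u.
  have [x xW dx] := condB Lm1 _ (ltnW wm); exact: leq_trans dx (umax x xW).
exact: (no_extremal_pair uy Lm1 nu ny eu ey du1 (leq_trans du1 duy)).
Qed.

End Endgame.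

Theorem theorem1p5 (n : nat) (T : finType) (E : hypergraph T) :
  40 < n -> #|T| = n ->
  (forall i, 1 <= i <= (n - 1) %/ 2 -> 2 ^ i < sdeg E i) ->
  (~~ odd n -> 2 ^ ((n - 2) %/ 2) + 1 < sdeg E ((n - 2) %/ 2)) ->
  has_hamiltonian_berge_cycle E.
Proof.
move=> n40 cardT condA condB; pose L := n.-1; pose m := (n - 1) %/ 2.
have cT : #|T| = L.+1 by rewrite cardT prednK //; lia.
have [hc|nh] := pselect (hcycle E L); first exact: (hcycle_hamiltonian cT hc).
have L1 : 1 < L by rewrite /L; lia.
have [E' [sub nh' ex]] := saturate cT L1 nh; exfalso.
(* Passing to [E'] only raises degrees, so both conditions carry over in their vertex-set form. *)
have mono x := hdegS x sub.
have m20 : 20 <= m by rewrite /m; lia.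
have Lm : L <= m.*2.+1 by rewrite /m /L; lia.
have mL : m.*2 <= L by rewrite /m /L; lia.
apply: (@hcycle_of_degrees _ E' L m) => //.
  move=> i X /andP[i0 im] iX; have di := condA i (introT andP (conj i0 im)).
  by have [x xX dx] := sdeg_ex i0 iX di; exists x => //; apply: leq_trans dx (mono x).
(* L = 2m + 1 says that [n] is even, and then [m] is the index in condition (2). *)
move=> Lm1 X mX; have mE : (n - 2) %/ 2 = m by move: Lm1; rewrite /m /L; lia.
have oddn : ~~ odd n by move: Lm1; rewrite /m /L; lia.
have := condB oddn; rewrite mE => dm.
have [x xX dx] := sdeg_ex (leq_trans (isT : 0 < 20) m20) mX dm.
by exists x => //; apply: leq_trans dx (mono x).
Qed.
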